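(* Let $\mathbf r=\mathbf r(t)$, $t\in(-\infty,\infty)$, be a solution of the Kepler problem $\ddot{\mathbf r}=-\frac{k\mathbf r}{r^3}$ with energy $h<0$ and angular momentum $\mathbf l\neq\mathbf 0$, and assume that $h\neq-\frac{m^3k^2}{2l^2}$ (i.e. the orbit is not a circle). Let $\mathbf A$ be the Laplace-Runge-Lenz vector of the solution and let $\beta\in\mathbb R$. Then the quantity $$\left|(\mathbf r+\beta^2\mathbf A)\times(\mathbf l+\beta\mathbf A)\right|$$ is constant in time if and only if $\beta=\pm\sqrt{\frac{-1}{2mh}}$.
   Context: Here $\mathbf r(t)\in\mathbb R^3\setminus\{\mathbf 0\}$ is the position of a body of mass $m>0$ and $k>0$ is a constant. The magnitude of a bold vector is denoted by the same letter in normal typeface, and dots denote time derivatives. The momentum is $\mathbf p=m\dot{\mathbf r}$; the angular momentum $\mathbf l=\mathbf r\times\mathbf p$ and the energy $h=\frac{p^2}{2m}-\frac{mk}{r}$ are constant in time along solutions. The Laplace-Runge-Lenz vector is $\mathbf A=\mathbf p\times\mathbf l-m^2k\frac{\mathbf r}{r}$, which is also constant in time along solutions. *)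

(* Defs.v *)
From mathcomp Require Import all_boot all_order all_algebra.
From mathcomp Require Import all_classical all_reals all_analysis.

Set Implicit Arguments.
Unset Strict Implicit.
Unset Printing Implicit Defensive.

Import Order.TTheory GRing.Theory Num.Theory.
Import numFieldNormedType.Exports.

Local Open Scope classical_set_scope.
Local Open Scope ring_scope.

(* Indices live in 'I_3 = Z/3, so i + 1 and i + 2 are taken cyclically:
   coordinate 0 is u_1 v_2 - u_2 v_1, and so on. *)
Definition cross (R : realType) (u v : 'rV[R]_3) : 'rV[R]_3 :=
  \row_(i < 3) (u 0 (i + 1) * v 0 (i + 2%:R) - u 0 (i + 2%:R) * v 0 (i + 1)).

(* The library norm `|u| on row vectors is the sup norm, not the Euclidean one;
   it is only used through the topology it induces (for derivatives). *)
Definition enorm (R : realType) (u : 'rV[R]_3) : R :=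
  Num.sqrt (\sum_(i < 3) u 0 i ^+ 2).

Definition kepler_solution (R : realType) (k : R) (r : R -> 'rV[R]_3) : Prop :=
  forall t : R, [/\ r t != 0,
    derivable r t 1,
    derivable (derive1 r) t 1 &
    derive1n 2 r t = - (k / enorm (r t) ^+ 3) *: r t].

Definition momentum (R : realType) (m : R) (r : R -> 'rV[R]_3) (t : R)
  : 'rV[R]_3 := m *: derive1 r t.

(* The next three quantities are conserved along solutions, but this is not
   built in: they are defined as functions of time for any curve. *)
Definition angular_momentum (R : realType) (m : R) (r : R -> 'rV[R]_3) (t : R)
  : 'rV[R]_3 := cross (r t) (momentum m r t).

Definition energy (R : realType) (m k : R) (r : R -> 'rV[R]_3) (t : R) : R :=
  enorm (momentum m r t) ^+ 2 / (2 * m) - m * k / enorm (r t).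

Definition laplace_runge_lenz (R : realType) (m k : R) (r : R -> 'rV[R]_3)
  (t : R) : 'rV[R]_3 :=
  cross (momentum m r t) (angular_momentum m r t)
  - (m ^+ 2 * k / enorm (r t)) *: r t.

(* Main.v *)
(* Since [l] is orthogonal to both [r] and [A], Lagrange's identity together with
   [r . A = l^2 - m^2 k |r|] and [A . A = m^4 k^2 + 2 m h l^2] shows that the
   squared quantity equals [l^2 (1 + 2 m h beta^2) |r|^2] plus a constant.
   Hence it is constant iff [1 + 2 m h beta^2 = 0] or [|r|] is constant, and
   the latter forces the excluded value of the energy. *)
Require Import Defs.
From mathcomp Require Import all_boot all_order all_algebra.
From mathcomp Require Import all_classical all_reals all_analysis.
From mathcomp Require Import ring lra.

Set Implicit Arguments.
Unset Strict Implicit.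
Unset Printing Implicit Defensive.

Import Order.TTheory GRing.Theory Num.Theory.
Import numFieldNormedType.Exports.

Local Open Scope classical_set_scope.
Local Open Scope ring_scope.

(** * Dot and cross product algebra in dimension three *)

Definition dot (R : realType) (u v : 'rV[R]_3) : R :=
  \sum_(i < 3) u 0 i * v 0 i.

Lemma sum_ord3 (R : realType) (F : 'I_3 -> R) :
  \sum_(i < 3) F i = F 0 + F 1 + F 2%:R.
Proof.
rewrite !big_ord_recl big_ord0 addr0 addrA.
by congr (F _ + F _ + F _); apply: val_inj.
Qed.

(** The cases are the ring literals of Z/3, the form in which [sum_ord3] and [crossE] present
    coordinates. *)
Lemma ord3P (P : 'I_3 -> Prop) : P 0 -> P 1 -> P 2%:R -> forall i, P i.
Proof.
move=> P0 P1 P2 [[|[|[|//]]] lt_i3].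
- by rewrite (_ : Ordinal _ = 0) //; apply: val_inj.
- by rewrite (_ : Ordinal _ = 1) //; apply: val_inj.
- by rewrite (_ : Ordinal _ = 2%:R) //; apply: val_inj.
Qed.

Lemma crossE (R : realType) (u v : 'rV[R]_3) :
  [/\ cross u v 0 0 = u 0 1 * v 0 2%:R - u 0 2%:R * v 0 1,
      cross u v 0 1 = u 0 2%:R * v 0 0 - u 0 0 * v 0 2%:R &
      cross u v 0 2%:R = u 0 0 * v 0 1 - u 0 1 * v 0 0].
Proof.
split; rewrite mxE; congr (u 0 _ * v 0 _ - u 0 _ * v 0 _); exact: val_inj.
Qed.

Lemma dotC (R : realType) (u v : 'rV[R]_3) : dot u v = dot v u.
Proof. by apply: eq_bigr => i _; rewrite mulrC. Qed.

Lemma dotDl (R : realType) (u v w : 'rV[R]_3) :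
  dot (u + v) w = dot u w + dot v w.
Proof. by rewrite /dot -big_split; apply: eq_bigr => i _; rewrite mxE mulrDl. Qed.

Lemma dotZl (R : realType) a (u w : 'rV[R]_3) : dot (a *: u) w = a * dot u w.
Proof. by rewrite /dot mulr_sumr; apply: eq_bigr => i _; rewrite mxE mulrA. Qed.

Lemma dotDr (R : realType) (u v w : 'rV[R]_3) :
  dot w (u + v) = dot w u + dot w v.
Proof. by rewrite dotC dotDl !(dotC w). Qed.

Lemma dotZr (R : realType) a (u w : 'rV[R]_3) : dot w (a *: u) = a * dot w u.
Proof. by rewrite dotC dotZl (dotC w). Qed.

Lemma dotBl (R : realType) (u v w : 'rV[R]_3) :
  dot (u - v) w = dot u w - dot v w.
Proof. by rewrite -scaleN1r dotDl dotZl mulN1r. Qed.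

Lemma dotBr (R : realType) (u v w : 'rV[R]_3) :
  dot w (u - v) = dot w u - dot w v.
Proof. by rewrite dotC dotBl !(dotC w). Qed.

Definition dot_lin := (dotBl, dotBr, dotDl, dotDr, dotZl, dotZr).

Lemma dot_ge0 (R : realType) (u : 'rV[R]_3) : 0 <= dot u u.
Proof. by apply: sumr_ge0 => i _; rewrite -expr2 sqr_ge0. Qed.

Lemma dot_gt0 (R : realType) (u : 'rV[R]_3) : u != 0 -> 0 < dot u u.
Proof.
move=> u_neq0; rewrite lt_neqAle dot_ge0 andbT eq_sym.
apply: contraNneq u_neq0 => /psumr_eq0P u0; apply/eqP/rowP => i.
by rewrite mxE; apply/eqP; rewrite -sqrf_eq0 expr2 u0// => j _; rewrite -expr2 sqr_ge0.
Qed.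

Lemma enormE (R : realType) (u : 'rV[R]_3) : enorm u = Num.sqrt (dot u u).
Proof. by congr Num.sqrt; apply: eq_bigr => i _; rewrite expr2. Qed.

Lemma sqr_enorm (R : realType) (u : 'rV[R]_3) : enorm u ^+ 2 = dot u u.
Proof. by rewrite enormE sqr_sqrtr ?dot_ge0. Qed.

Lemma enorm_gt0 (R : realType) (u : 'rV[R]_3) : u != 0 -> 0 < enorm u.
Proof. by move=> /dot_gt0; rewrite enormE sqrtr_gt0. Qed.

Lemma dot_cross_cross (R : realType) (u v : 'rV[R]_3) :
  dot (cross u v) (cross u v) = dot u u * dot v v - dot u v ^+ 2.
Proof. by rewrite /dot !sum_ord3; have [-> -> ->] := crossE u v; ring. Qed.

Lemma dot_crossl (R : realType) (u v : 'rV[R]_3) : dot u (cross u v) = 0.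
Proof. by rewrite /dot !sum_ord3; have [-> -> ->] := crossE u v; ring. Qed.

Lemma dot_crossr (R : realType) (u v : 'rV[R]_3) : dot v (cross u v) = 0.
Proof. by rewrite /dot !sum_ord3; have [-> -> ->] := crossE u v; ring. Qed.

Lemma cross_cross (R : realType) (u v : 'rV[R]_3) :
  cross v (cross u v) = dot v v *: u - dot u v *: v.
Proof.
apply/rowP; have [w0 w1 w2] := crossE v (cross u v).
rewrite /dot !sum_ord3; have [c0 c1 c2] := crossE u v.
by apply: ord3P; rewrite ?w0 ?w1 ?w2 ?c0 ?c1 ?c2 !mxE; ring.
Qed.

(** The triple product rule puts [A] in the orbital plane, as a combination of [r t] and [p]; every
    dot product with [A] then reduces to [dot r r], [dot r p] and [dot p p]. *)
Lemma LRL_expand (R : realType) (m k : R) (r : R -> 'rV[R]_3) t :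
  let p := momentum m r t in
  laplace_runge_lenz m k r t =
    (dot p p - m ^+ 2 * k / enorm (r t)) *: r t - dot (r t) p *: p.
Proof. by rewrite /laplace_runge_lenz cross_cross scalerBl addrAC. Qed.

(** * Pointwise identities relating position, angular momentum and the Laplace-Runge-Lenz vector *)

Section Invariants.
Variables (R : realType) (m k : R) (r : R -> 'rV[R]_3) (t : R).
Hypotheses (m_gt0 : 0 < m) (rt_neq0 : r t != 0).
Let l := angular_momentum m r t.
Let A := laplace_runge_lenz m k r t.

Lemma dot_LRL_l : dot A l = 0.
Proof.
rewrite /A LRL_expand /l /angular_momentum; move: (momentum m r t) => p.
by rewrite !dot_lin dot_crossl dot_crossr !mulr0 subr0.
Qed.

Lemma dot_r_LRL : dot (r t) A = dot l l - m ^+ 2 * k * enorm (r t).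
Proof.
rewrite /A LRL_expand /l /angular_momentum; move: (momentum m r t) => p.
rewrite !dot_lin dot_cross_cross -(sqr_enorm (r t)).
have := enorm_gt0 rt_neq0; set rho := enorm (r t) => rho_gt0.
by field; rewrite gt_eqF.
Qed.

(** The energy enters through [dot p p] = 2m(h + mk/r). Since the identity holds at each time
    separately, it also transfers conservation from [A] and [l] to the energy. *)
Lemma dot_LRL_LRL :
  dot A A = m ^+ 4 * k ^+ 2 + 2 * m * energy m k r t * dot l l.
Proof.
rewrite /A LRL_expand /energy sqr_enorm /l /angular_momentum.
move: (momentum m r t) => p.
rewrite !dot_lin dot_cross_cross (dotC p (r t)) -(sqr_enorm (r t)).
have := enorm_gt0 rt_neq0; set rho := enorm (r t) => rho_gt0.
by field; rewrite !gt_eqF.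
Qed.

(* Lagrange's identity turns the squared norm into dot products, of which only
   [dot (r t) A] and [dot (r t) (r t)] vary in time; the terms linear in
   [enorm (r t)] cancel. *)
Lemma sqr_enorm_quantity beta :
  enorm (cross (r t + beta ^+ 2 *: A) (l + beta *: A)) ^+ 2 =
  dot l l * (1 + 2 * m * energy m k r t * beta ^+ 2) * dot (r t) (r t)
  + (2 * beta ^+ 2 * dot l l ^+ 2 + beta ^+ 4 * dot l l * dot A A
     - beta ^+ 2 * dot l l ^+ 2).
Proof.
have rl : dot (r t) l = 0 by exact: dot_crossl.
move: dot_LRL_l dot_r_LRL dot_LRL_LRL rl; move: A l => A' l' Al rA AA rl.
rewrite sqr_enorm dot_cross_cross !dot_lin !(dotC l') !(dotC A' (r t)).
by rewrite Al rl rA AA -(sqr_enorm (r t)); ring.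
Qed.

End Invariants.

(** * Derivatives of coordinates and of dot products *)

Lemma is_derive_coord (R : realType) (f : R -> 'rV[R]_3) (t : R) i :
  derivable f t 1 -> is_derive t 1 (fun s => f s 0 i) (derive1 f t 0 i).
Proof.
move=> df; apply: DeriveDef; first exact: (derivable_mxP f t 1).1.
by rewrite derive1E derive_mx // mxE.
Qed.

(** The product rule with ring multiplication in place of scaling, so that computed derivatives are
    ready for [ring] and [field]. *)
Lemma is_derive_mul (R : realType) (f g : R -> R) (t df dg : R) :
  is_derive t 1 f df -> is_derive t 1 g dg ->
  is_derive t 1 (fun s => f s * g s) (df * g t + f t * dg).
Proof.
move=> fD gD; apply: (is_derive_eq (is_deriveM fD gD)).
by rewrite addrC /= mulrC.
Qed.

Lemma is_derive_dot (R : realType) (f g : R -> 'rV[R]_3) (df dg : 'rV[R]_3) (t : R) :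
  (forall i, is_derive t 1 (fun s => f s 0 i) (df 0 i)) ->
  (forall i, is_derive t 1 (fun s => g s 0 i) (dg 0 i)) ->
  is_derive t 1 (fun s => dot (f s) (g s)) (dot df (g t) + dot (f t) dg).
Proof.
move=> fD gD.
rewrite (_ : (fun s => _) = \sum_(i < 3) (fun s => f s 0 i * g s 0 i)); last first.
  by apply/funext => s; rewrite fct_sumE.
rewrite /dot -big_split; apply: is_derive_sum => i; exact: is_derive_mul.
Qed.

(** * Conservation laws along Kepler solutions, and the energy of circular orbits *)

Section Kepler.
Variables (R : realType) (m k : R) (r : R -> 'rV[R]_3).
Hypothesis r_sol : kepler_solution k r.
Let a t := - (k / enorm (r t) ^+ 3) *: r t.

Lemma is_derive_r (t : R) i : is_derive t 1 (fun s => r s 0 i) (derive1 r t 0 i).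
Proof. by have [_ ? _ _] := r_sol t; apply: is_derive_coord. Qed.

Lemma is_derive_v (t : R) i : is_derive t 1 (fun s => derive1 r s 0 i) (a t 0 i).
Proof.
by have [_ _ ? aE] := r_sol t; rewrite /a -aE; apply: is_derive_coord.
Qed.

Lemma is_derive_inv_enorm (t : R) :
  is_derive t 1 (fun s => (enorm (r s))^-1)
    (- dot (r t) (derive1 r t) / enorm (r t) ^+ 3).
Proof.
have [r_neq0 _ _ _] := r_sol t; have rho_gt0 := enorm_gt0 r_neq0.
have dD := is_derive_dot (is_derive_r t) (is_derive_r t).
have sD : is_derive t 1 (fun s => enorm (r s)) (dot (r t) (derive1 r t) / enorm (r t)).
  rewrite (_ : (fun s => _) = Num.sqrt \o (fun s => dot (r s) (r s))); last first.
    by apply/funext => s; rewrite /= enormE.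
  (* Chain rule; the square root is differentiable here because [dot (r t) (r t)] is positive. *)
  apply: (is_derive_eq (is_derive1_comp (is_derive1_sqrt (dot_gt0 r_neq0)) dD)).
  rewrite -enormE (dotC _ (r t)) /=.
  by field; rewrite gt_eqF.
apply: (is_derive_eq (is_deriveV _ sD)); first by rewrite gt_eqF.
by rewrite /GRing.scale /=; field; rewrite gt_eqF.
Qed.

(** The derivative is m(v x v + r x a), and the acceleration [a] is parallel to [r]. *)
Lemma angular_momentum_cst t s : angular_momentum m r t = angular_momentum m r s.
Proof.
apply/rowP => i; apply: (@is_derive_0_is_cst _ (fun t => angular_momentum m r t 0 i)).
move=> {t s} t.
rewrite (_ : (fun _ => _) = fun t =>
    m * (r t 0 (i + 1) * derive1 r t 0 (i + 2%:R))
    - m * (r t 0 (i + 2%:R) * derive1 r t 0 (i + 1))); last first.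
  by apply/funext => s; rewrite !mxE; ring.
(* The derivative is left open, to be filled in by the product rules and then compared with 0. *)
apply: is_derive_eq.
  apply: is_deriveB; apply: is_derive_mul;
    apply: is_derive_mul; solve [exact: is_derive_r | exact: is_derive_v].
by rewrite /a !mxE; ring.
Qed.

(** In the derivative of A/m^2 the coefficient of [r] is (-2 + 1 + 1) k (r.v)/r^3, from v.v, 1/r and
    the acceleration in turn; that of [v] is v.v - k/r - (v.v - k/r). *)
Lemma laplace_runge_lenz_cst t s :
  laplace_runge_lenz m k r t = laplace_runge_lenz m k r s.
Proof.
apply/rowP => i.
apply: (@is_derive_0_is_cst _ (fun t => laplace_runge_lenz m k r t 0 i)).
move=> {t s} t; have [r_neq0 _ _ _] := r_sol t.
have rho_gt0 := enorm_gt0 r_neq0.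
pose v := derive1 r.
rewrite (_ : (fun _ => _) = fun t =>
    m ^+ 2 * ((dot (v t) (v t) - k * (enorm (r t))^-1) * r t 0 i
              - dot (r t) (v t) * v t 0 i)); last first.
  by apply/funext => s; rewrite LRL_expand !mxE /momentum !dot_lin -/v; ring.
apply: is_derive_eq.
  apply: is_derive_mul.
  apply: is_deriveB; apply: is_derive_mul.
  - apply: is_deriveB; first by apply: is_derive_dot; exact: is_derive_v.
    by apply: is_derive_mul; exact: is_derive_inv_enorm.
  - exact: is_derive_r.
  - by apply: is_derive_dot; [exact: is_derive_r | exact: is_derive_v].
  - exact: is_derive_v.
rewrite /a !dot_lin (dotC (v t) (r t)) -/v -(sqr_enorm (r t)) !mxE.
by field; rewrite gt_eqF.
Qed.

(* Differentiating the constant [dot (r t) (r t)] twice gives [v^2 = k / r]. *)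
Lemma energy_circular t (c := enorm (angular_momentum m r t) ^+ 2) :
  0 < m -> 0 < k -> (forall s, dot (r s) (r s) = dot (r t) (r t)) ->
  energy m k r t = - (m ^+ 3 * k ^+ 2 / (2 * c)).
Proof.
move=> m_gt0 k_gt0 rr_cst; have [r_neq0 _ _ _] := r_sol t.
have rho_gt0 := enorm_gt0 r_neq0.
pose v := derive1 r.
have rv0 s : dot (r s) (v s) = 0.
  have rrD := is_derive_dot (is_derive_r s) (is_derive_r s).
  have := @derive_val _ _ _ _ _ _ _ rrD.
  rewrite (_ : (fun s => _) = cst (dot (r t) (r t))); last exact/funext.
  by rewrite derive_cst (dotC _ (r s)) -/v; lra.
have vv : dot (v t) (v t) = k / enorm (r t).
  have rvD := is_derive_dot (is_derive_r t) (is_derive_v t).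
  have := @derive_val _ _ _ _ _ _ _ rvD.
  rewrite (_ : (fun s => _) = cst 0); last exact/funext.
  rewrite derive_cst /a !dot_lin -/v -(sqr_enorm (r t)) => /eqP.
  rewrite eq_sym addr_eq0 => /eqP ->.
  by field; rewrite gt_eqF.
(* Now c = m^2 k r and the energy is -mk/(2r); eliminating the radius gives the claim. *)
rewrite /c /energy !sqr_enorm dot_cross_cross /momentum !dot_lin rv0 vv.
rewrite -(sqr_enorm (r t)).
by field; rewrite !gt_eqF.
Qed.

End Kepler.

Theorem theorem4p2 (R : realType) (m k : R) (m_gt0 : 0 < m) (k_gt0 : 0 < k)
    (r : R -> 'rV[R]_3) (r_sol : kepler_solution k r)
    (t0 h : R) (l A : 'rV[R]_3)
    (hE : h = energy m k r t0)
    (lE : l = angular_momentum m r t0)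
    (AE : A = laplace_runge_lenz m k r t0)
    (h_lt0 : h < 0) (l_neq0 : l <> 0)
    (not_circle : h <> - (m ^+ 3 * k ^+ 2 / (2 * enorm l ^+ 2)))
    (beta : R) :
  (exists c : R, forall t : R,
     enorm (cross (r t + beta ^+ 2 *: A) (l + beta *: A)) = c)
  <->
  (beta = Num.sqrt (-1 / (2 * m * h)) \/ beta = - Num.sqrt (-1 / (2 * m * h))).
Proof.
have lt t : l = angular_momentum m r t.
  by rewrite lE; apply: angular_momentum_cst r_sol _ _.
have At t : A = laplace_runge_lenz m k r t.
  by rewrite AE; apply: laplace_runge_lenz_cst r_sol _ _.
have r_neq0 t : r t != 0 by have [] := r_sol t.
have l2_gt0 : 0 < dot l l by apply/dot_gt0/eqP.
(* Energy conservation: [dot A A] is the same at [t] and [t0], and the nonzero factors [dot l l] and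
   2m cancel. *)
have ht t : h = energy m k r t.
  have := dot_LRL_LRL k m_gt0 (r_neq0 t); rewrite -At -lt.
  have := dot_LRL_LRL k m_gt0 (r_neq0 t0); rewrite -AE -lE -hE => -> /addrI.
  move=> /(mulIf (lt0r_neq0 l2_gt0)) /mulfI; apply.
  by rewrite gt_eqF // mulr_gt0.
have mh_neq0 : 2 * m * h != 0 by rewrite lt_eqF // pmulr_rlt0 ?mulr_gt0.
have betaP : 1 + 2 * m * h * beta ^+ 2 = 0 <->
    (beta = Num.sqrt (-1 / (2 * m * h)) \/ beta = - Num.sqrt (-1 / (2 * m * h))).
  (* As h < 0, the radicand is nonnegative, so the root is a genuine one and not the default value
     0. *)
  have s2 : Num.sqrt (-1 / (2 * m * h)) ^+ 2 = -1 / (2 * m * h).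
    rewrite sqr_sqrtr // mulN1r oppr_ge0 invr_le0 pmulr_rle0 ?mulr_gt0 //.
    exact: ltW.
  split=> [b0|b]; last first.
    have -> : beta ^+ 2 = -1 / (2 * m * h).
      by rewrite -s2; case: b => ->; rewrite ?sqrrN.
    by field; move: mh_neq0; rewrite !mulf_eq0 !negb_or => /andP[/andP[_ ->] ->].
  have : beta ^+ 2 == Num.sqrt (-1 / (2 * m * h)) ^+ 2.
    rewrite s2; apply/eqP/(mulfI mh_neq0); rewrite [RHS]mulrCA divff // mulr1.
    by apply/eqP; rewrite -addr_eq0 addrC b0.
  by rewrite eqf_sqr => /orP[] /eqP ->; [left | right].
pose K := 2 * beta ^+ 2 * dot l l ^+ 2 + beta ^+ 4 * dot l l * dot A A
          - beta ^+ 2 * dot l l ^+ 2.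
have qE t : enorm (cross (r t + beta ^+ 2 *: A) (l + beta *: A)) ^+ 2 =
    dot l l * (1 + 2 * m * h * beta ^+ 2) * dot (r t) (r t) + K.
  by rewrite /K (At t) (lt t) (ht t) sqr_enorm_quantity.
apply: iff_trans betaP; split=> [[c qc]|b0].
  (* If the coefficient of [dot (r t) (r t)] were nonzero, comparing the squares at [s] and [t0]
     would make the radius constant, hence the energy the excluded one. *)
  apply: contrapT => /eqP b_neq0; apply: not_circle; rewrite hE lE.
  apply: energy_circular => // s.
  have := qE t0; rewrite qc -(qc s) qE => /addIr /mulfI; apply.
  by rewrite mulf_neq0 // gt_eqF.
(* The squared norm is now [K], and a norm is the nonnegative root of its square. *)
exists (Num.sqrt K) => t.
by rewrite -[LHS]ger0_norm ?sqrtr_ge0 // -sqrtr_sqr qE b0 mulr0 mul0r add0r.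
Qed.
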